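(* Let $\mathbf{k}$ be a field of characteristic zero and let $B = \mathbf{k}[X,Y]$ be a polynomial ring in two variables over $\mathbf{k}$. Then there exists a degree function $\deg : B \to \mathbb{Z}\cup\{-\infty\}$ satisfying: (a) $\deg(\lambda)=0$ for all $\lambda \in \mathbf{k}^*$; (b) $\operatorname{Gr}(B) \cong \mathbf{k}[t,t^{-1}]$; (c) the only $\mathbf{k}$-derivation $D : B \to B$ such that $\deg(D)$ is defined is the zero derivation.
   Context: A degree function on a ring $B$ with values in a totally ordered abelian group $G$ is a map $\deg : B \to G\cup\{-\infty\}$ such that for all $x,y\in B$: (1) $\deg(x)=-\infty$ iff $x=0$; (2) $\deg(xy)=\deg x+\deg y$; (3) $\deg(x+y)\le\max(\deg x,\deg y)$. For a derivation $D:B\to B$ of an integral domain $B$ with degree function $\deg$, let $U=\{\deg(Dx)-\deg(x) : x\in B\setminus\{0\}\}\subseteq G\cup\{-\infty\}$. If $U$ has a greatest element, $\deg(D)$ is defined to be that element; otherwise $\deg(D)$ is said to be not defined. (For $G=\mathbb{Z}$, $\deg(D)$ is defined iff $U$ is bounded above.) Associated graded ring: for $i\in G$ put $B_i=\{x\in B:\deg(x)\le i\}$, $B_{i^-}=\{x\in B:\deg(x)<i\}$, $B_{[i]}=B_i/B_{i^-}$; then $\operatorname{Gr}(B)=\bigoplus_{i\in G}B_{[i]}$, a $G$-graded integral domain with multiplication induced by that of $B$. When $\deg(\lambda)=0$ for all $\lambda\in\mathbf{k}^*$, $\operatorname{Gr}(B)$ is a $\mathbf{k}$-algebra via $\mathbf{k}\to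 B_0\to B_{[0]}$. *)

(* Defs.v *)
From HB Require Import structures.
From mathcomp Require Import all_boot all_order all_algebra.
From mathcomp Require Import mpoly.
From mathcomp Require Import boolp classical_sets cardinality fsbigop.

Set Implicit Arguments.
Unset Strict Implicit.
Unset Printing Implicit Defensive.

Import Order.TTheory GRing.Theory Num.Theory.
Local Open Scope ring_scope.
Local Open Scope quotient_scope.
Local Open Scope classical_set_scope.

(* The value monoid Z u {-oo}; [None] stands for -oo. *)
Definition degval := option int.

Definition dadd (u v : degval) : degval :=
  if (u, v) is (Some a, Some b) then Some (a + b) else None.

(* [dsub u v] is only meaningful when v is finite, the only case used below. *)
Definition dsub (u v : degval) : degval :=
  if (u, v) is (Some a, Some b) then Some (a - b) else None.

Definition dle (u v : degval) : bool :=
  match u, v with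
  | None, _ => true
  | Some _, None => false
  | Some a, Some b => a <= b
  end.

Definition dlt (u v : degval) : bool := ~~ dle v u.

Definition dmax (u v : degval) : degval := if dle u v then v else u.

Record degree_function (B : comNzRingType) := DegreeFunction {
  degf :> B -> degval;
  degf_eqNone : forall x, degf x = None <-> x = 0;
  degfM : forall x y, degf (x * y) = dadd (degf x) (degf y);
  degfD : forall x y, dle (degf (x + y)) (dmax (degf x) (degf y))
}.

Section DegreeOfDerivation.
Variables (B : comNzRingType) (deg : degree_function B).

Definition is_derivation (D : B -> B) : Prop :=
  forall x y, D (x * y) = D x * y + x * D y.

Definition deg_shifts (D : B -> B) : set degval :=
  [set u | exists2 x, x != 0 & u = dsub (deg (D x)) (deg x)].

(* deg(D) is defined iff the set of shifts has a greatest element. *)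
Definition deg_defined (D : B -> B) : Prop :=
  exists2 m, deg_shifts D m & forall u, deg_shifts D u -> dle u m.

End DegreeOfDerivation.

(* Multiplicative data on a Z-indexed family of abelian groups turning the
   direct sum of the family into a commutative Z-graded ring.  The product
   M_i x M_j -> M_n takes a proof of i + j = n, so that no transport along
   equalities of indices is needed. *)
Record graded_data := GradedData {
  gcomp :> int -> zmodType;
  gone : gcomp 0;
  gmul : forall i j n : int, i + j = n -> gcomp i -> gcomp j -> gcomp n;
  gmulDl : forall (i j n : int) (e : i + j = n) (u u' : gcomp i) (v : gcomp j),
    gmul e (u + u') v = gmul e u v + gmul e u' v;
  gmulC : forall (i j n : int) (e : i + j = n) (e' : j + i = n)
    (u : gcomp i) (v : gcomp j), gmul e u v = gmul e' v u;
  gmul1 : forall (i : int) (e : 0 + i = i) (u : gcomp i), gmul e gone u = u;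
  gmulA : forall (i j l m p n : int) (e1 : j + l = m) (e2 : i + m = n)
    (e3 : i + j = p) (e4 : p + l = n)
    (u : gcomp i) (v : gcomp j) (w : gcomp l),
    gmul e2 u (gmul e1 v w) = gmul e4 (gmul e3 u v) w;
  gone_neq0 : gone != 0
}.

Section DirectSum.
Variable M : int -> zmodType.

Record dsum := DSum {
  dcoef :> forall i, M i;
  dcoef_fin : finite_set [set i | dcoef i != 0]
}.

HB.instance Definition _ := gen_eqMixin dsum.
HB.instance Definition _ := gen_choiceMixin dsum.

Lemma dsum_ext (f g : dsum) : (forall i, f i = g i) -> f = g.
Proof.
case: f g => [f hf] [g hg] /= E.
have {}E : f = g by apply: functional_extensionality_dep.
by case: _ / E hg => hg; congr DSum; apply: Prop_irrelevance.
Qed.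

Lemma dsum0_fin : finite_set [set i | (0 : M i) != 0].
Proof. by apply: (sub_finite_set _ (finite_set0 int)) => i /=; rewrite eqxx. Qed.
Definition dsum0 := DSum dsum0_fin.

Lemma dsumN_fin (f : dsum) : finite_set [set i | - f i != 0].
Proof.
by apply: (sub_finite_set _ (dcoef_fin f)) => i /=; rewrite oppr_eq0.
Qed.
Definition dsumN (f : dsum) := DSum (dsumN_fin f).

Lemma dsumD_fin (f g : dsum) : finite_set [set i | f i + g i != 0].
Proof.
apply: (@sub_finite_set _ _ ([set i | f i != 0] `|` [set i | g i != 0])).
  move=> i /= h; case: (eqVneq (f i) 0) => [fi|]; last by left.
  by right; move: h; rewrite fi add0r.
by rewrite finite_setU; split; apply: dcoef_fin.
Qed.
Definition dsumD (f g : dsum) := DSum (dsumD_fin f g).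

Lemma dsumDA : associative dsumD.
Proof. by move=> f g h; apply: dsum_ext => i /=; rewrite addrA. Qed.
Lemma dsumDC : commutative dsumD.
Proof. by move=> f g; apply: dsum_ext => i /=; rewrite addrC. Qed.
Lemma dsumD0 : left_id dsum0 dsumD.
Proof. by move=> f; apply: dsum_ext => i /=; rewrite add0r. Qed.
Lemma dsumDN : left_inverse dsum0 dsumN dsumD.
Proof. by move=> f; apply: dsum_ext => i /=; rewrite addNr. Qed.

HB.instance Definition _ :=
  GRing.isZmodule.Build dsum dsumDA dsumDC dsumD0 dsumDN.

Lemma dcoef0 i : (0 : dsum) i = 0. Proof. by []. Qed.
Lemma dcoefD (f g : dsum) i : (f + g) i = f i + g i. Proof. by []. Qed.
Lemma dcoefN (f : dsum) i : (- f) i = - f i. Proof. by []. Qed.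
Lemma dcoef_sum I (s : seq I) (F : I -> dsum) i :
  (\sum_(j <- s) F j) i = \sum_(j <- s) F j i.
Proof.
by elim: s => [|j s ih]; rewrite ?big_nil // !big_cons dcoefD ih.
Qed.

Definition dsingle_fun (i : int) (u : M i) (j : int) : M j :=
  if i =P j is ReflectT e then ecast j (M j) e u else 0.

Lemma dsingle_funE i (u : M i) : dsingle_fun u i = u.
Proof.
by rewrite /dsingle_fun; case: eqP => // e; rewrite (eq_axiomK e).
Qed.

Lemma dsingle_funN i (u : M i) j : i != j -> dsingle_fun u j = 0.
Proof. by rewrite /dsingle_fun; case: eqP. Qed.

Lemma dsingle_fin i (u : M i) : finite_set [set j | dsingle_fun u j != 0].
Proof.
apply: (sub_finite_set _ (finite_set1 i)) => j /=.
by case: (eqVneq i j) => // h; rewrite dsingle_funN // eqxx.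
Qed.
Definition dsingle i (u : M i) := DSum (dsingle_fin u).

Lemma dsingleE i (u : M i) : dsingle u i = u.
Proof. exact: dsingle_funE. Qed.
Lemma dsingleN i (u : M i) j : i != j -> dsingle u j = 0.
Proof. exact: dsingle_funN. Qed.

Lemma dsum_seq (f : dsum) : exists2 s : seq int, uniq s &
  forall i, i \notin s -> f i = 0.
Proof.
have /finite_seqP[s Es] := dcoef_fin f.
exists (undup s); first exact: undup_uniq.
move=> i; rewrite mem_undup => /negP his; apply/eqP; apply: contrapT => /negP h.
by apply: his; have : [set i | f i != 0] i by []; rewrite Es.
Qed.

Lemma dsum_decomp (f : dsum) (s : seq int) : uniq s ->
  (forall i, i \notin s -> f i = 0) -> f = \sum_(i <- s) dsingle (f i).
Proof.
move=> us hs; apply: dsum_ext => i; rewrite dcoef_sum.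
case: (boolP (i \in s)) => his.
  rewrite (bigD1_seq i) //= dsingle_funE big1 ?addr0 // => j hj.
  by rewrite dsingle_funN.
rewrite hs // big_seq big1 // => j hj; rewrite dsingleN //.
by apply: contraNneq his => <-.
Qed.

Lemma dsum_ind (P : dsum -> Prop) :
  P 0 -> (forall f g, P f -> P g -> P (f + g)) ->
  (forall i (u : M i), P (dsingle u)) -> forall f, P f.
Proof.
move=> P0 PD P1 f; have [s us hs] := dsum_seq f.
rewrite (dsum_decomp us hs); elim: s {us hs} => [|i s ih].
  by rewrite big_nil.
by rewrite big_cons; apply: PD.
Qed.

End DirectSum.

Section DirectSumRing.
Variable M : graded_data.
Implicit Types f g h : dsum M.

Lemma gmulDr (i j n : int) (e : i + j = n) (u : M i) (v v' : M j) :
  gmul e u (v + v') = gmul e u v + gmul e u v'.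
Proof.
have e' : j + i = n by rewrite addrC.
by rewrite !(gmulC e e') gmulDl.
Qed.

Lemma gmul0l (i j n : int) (e : i + j = n) (v : M j) : gmul e 0 v = 0.
Proof. by apply: (addrI (gmul e 0 v)); rewrite -gmulDl !addr0. Qed.

Lemma gmul0r (i j n : int) (e : i + j = n) (u : M i) : gmul e u 0 = 0.
Proof. by apply: (addrI (gmul e u 0)); rewrite -gmulDr !addr0. Qed.

Definition dsummul_fun f g (n : int) : M n :=
  \sum_(i \in [set: int]) gmul (subrKC i n) (f i) (g (n - i)).

Lemma dsummul_funE f g n (s : seq int) : uniq s ->
  (forall i, i \notin s -> f i = 0) ->
  dsummul_fun f g n = \sum_(i <- s) gmul (subrKC i n) (f i) (g (n - i)).
Proof.
move=> us hs; rewrite /dsummul_fun.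
rewrite [RHS]fsbig_seq //; apply: esym.
apply: (@fsbig_widen _ _ _ _ [set` s] setT) => // i [_ /negP hi] /=.
by rewrite hs ?gmul0l.
Qed.

Lemma dsummul_fin f g : finite_set [set n | dsummul_fun f g n != 0].
Proof.
have [s us hs] := dsum_seq f; have [t ut ht] := dsum_seq g.
apply: (sub_finite_set _ (finite_seq [seq i + j | i <- s, j <- t])) => n /=.
rewrite (dsummul_funE _ _ us hs); apply: contraNT => hn.
rewrite big_seq big1 // => i hi; rewrite (ht (n - i)) ?gmul0r //.
apply: contra hn => hj; apply/allpairsP; exists (i, n - i) => /=.
by split => //; rewrite subrKC.
Qed.
Definition dsummul f g := DSum (dsummul_fin f g).

Lemma dsummulE f g n (s : seq int) : uniq s ->
  (forall i, i \notin s -> f i = 0) ->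
  dsummul f g n = \sum_(i <- s) gmul (subrKC i n) (f i) (g (n - i)).
Proof. exact: dsummul_funE. Qed.

Lemma dsummulDr : right_distributive dsummul +%R.
Proof.
move=> f g h; apply: dsum_ext => n; have [s us hs] := dsum_seq f.
rewrite dcoefD !(dsummulE _ _ us hs) -big_split /=.
by apply: eq_bigr => i _; rewrite -gmulDr.
Qed.

Lemma dsummulDl : left_distributive dsummul +%R.
Proof.
move=> f g h; apply: dsum_ext => n.
have [s us hs] := dsum_seq f; have [t ut ht] := dsum_seq g.
have ur := undup_uniq (s ++ t).
have hr i : i \notin undup (s ++ t) -> f i = 0 /\ g i = 0.
  by rewrite mem_undup mem_cat negb_or => /andP[/hs-> /ht->].
rewrite dcoefD !(dsummulE _ _ ur).
- by rewrite -big_split /=; apply: eq_bigr => i _; rewrite -gmulDl.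
- by move=> i /hr[].
- by move=> i /hr[].
- by move=> i /hr[h1 h2]; rewrite dcoefD h1 h2 addr0.
Qed.

Lemma dsummul0f h : dsummul 0 h = 0.
Proof. by apply: (addrI (dsummul 0 h)); rewrite -dsummulDl !addr0. Qed.

Lemma dsummulf0 h : dsummul h 0 = 0.
Proof. by apply: (addrI (dsummul h 0)); rewrite -dsummulDr !addr0. Qed.

Lemma gmul_dsingle (i j m n : int) (e : i + m = n) (u : M i) (v : M j) :
  gmul e u (dsingle v m) = dsingle (gmul (erefl (i + j)) u v) n.
Proof.
case: (eqVneq j m) => [E|hjm].
  by subst m; subst n; rewrite !dsingleE.
rewrite !dsingleN ?gmul0r // -e.
by apply: contraNneq hjm => /addrI->.
Qed.

Lemma dsummul_single i j (u : M i) (v : M j) :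
  dsummul (dsingle u) (dsingle v) = dsingle (gmul (erefl (i + j)) u v).
Proof.
apply: dsum_ext => n; rewrite (@dsummulE _ _ _ [:: i]) //; last first.
  by move=> l; rewrite inE => hl; rewrite dsingleN // eq_sym.
by rewrite big_seq1 dsingleE gmul_dsingle.
Qed.

Lemma dsingle_gmul (i j n : int) (e : i + j = n) (u : M i) (v : M j) :
  dsingle (gmul (erefl (i + j)) u v) = dsingle (gmul e u v).
Proof. by subst n. Qed.

Definition dsum1 : dsum M := dsingle (gone M).

Lemma dsummulC : commutative dsummul.
Proof.
move=> f g; elim/dsum_ind: f => [|f f' hf hf'|i u].
- by rewrite dsummul0f dsummulf0.
- by rewrite dsummulDl dsummulDr hf hf'.
elim/dsum_ind: g => [|g g' hg hg'|j v].
- by rewrite dsummul0f dsummulf0.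
- by rewrite dsummulDl dsummulDr hg hg'.
rewrite !dsummul_single (dsingle_gmul (addrC i j)).
by rewrite (gmulC _ (erefl (j + i))).
Qed.

Lemma dsummulA : associative dsummul.
Proof.
move=> f g h; elim/dsum_ind: f => [|f f' hf hf'|i u].
- by rewrite !dsummul0f.
- by rewrite !dsummulDl hf hf'.
elim/dsum_ind: g => [|g g' hg hg'|j v].
- by rewrite dsummulf0 !dsummul0f dsummulf0.
- by rewrite !(dsummulDl, dsummulDr) hg hg'.
elim/dsum_ind: h => [|h h' hh hh'|l w].
- by rewrite !dsummulf0.
- by rewrite !dsummulDr hh hh'.
rewrite !dsummul_single (dsingle_gmul (addrA i j l)).
by rewrite (gmulA (erefl (j + l)) _ (erefl (i + j)) (erefl (i + j + l))).
Qed.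

Lemma dsummul1 : left_id dsum1 dsummul.
Proof.
move=> f; elim/dsum_ind: f => [|f g hf hg|i u]; first exact: dsummulf0.
  by rewrite dsummulDr hf hg.
by rewrite dsummul_single (dsingle_gmul (add0r i)) gmul1.
Qed.

Lemma dsum1_neq0 : dsum1 != 0.
Proof.
apply: contraNneq (gone_neq0 M) => E.
by rewrite -(dsingleE (gone M)) -/dsum1 E.
Qed.

HB.instance Definition _ := GRing.Zmodule_isComNzRing.Build (dsum M)
  dsummulA dsummulC dsummul1 dsummulDl dsum1_neq0.

End DirectSumRing.

(* Laurent polynomials k[t, 1/t]: finitely supported coefficient families
   indexed by Z, with the convolution product. *)
Section Laurent.
Variable k : fieldType.

Definition laurent_mul (i j n : int) (_ : i + j = n) (a b : k) : k := a * b.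

Program Definition laurent_data : graded_data :=
  @GradedData (fun _ => k) 1 laurent_mul _ _ _ _ _.
Next Obligation. by rewrite /laurent_mul mulrDl. Qed.
Next Obligation. by rewrite /laurent_mul mulrC. Qed.
Next Obligation. by rewrite /laurent_mul mul1r. Qed.
Next Obligation. by rewrite /laurent_mul mulrA. Qed.
Next Obligation. exact: oner_neq0. Qed.

Definition laurent : comNzRingType := dsum laurent_data.

Definition laurentC (c : k) : laurent := @dsingle laurent_data 0 c.

End Laurent.

Section DegreeTheory.
Variables (B : comNzRingType) (deg : degree_function B).

Lemma dle_trans (v u w : degval) : dle u v -> dle v w -> dle u w.
Proof. by case: u v w => [a|] [b|] [c|] //=; apply: le_trans. Qed.

Lemma dlt_le (u v : degval) : dlt u v -> dle u v.
Proof. by case: u v => [a|] [b|] //=; rewrite /dlt /= -ltNge; apply: ltW. Qed.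

Lemma dle_dmax (u v w : degval) : dle u w -> dle v w -> dle (dmax u v) w.
Proof. by rewrite /dmax; case: ifP. Qed.

Lemma dlt_dmax (u v w : degval) : dlt u w -> dlt v w -> dlt (dmax u v) w.
Proof. by rewrite /dmax; case: ifP. Qed.

Lemma dle_lt_trans (v u w : degval) : dle u v -> dlt v w -> dlt u w.
Proof.
by move=> uv; apply: contra => wu; apply: dle_trans wu uv.
Qed.

Lemma degf0 : deg 0 = None.
Proof. exact/degf_eqNone. Qed.

Lemma degf1 : deg 1 = Some 0.
Proof.
have := degfM deg 1 1; rewrite mulr1; case E: (deg 1) => [a|] /=.
  by case=> /eqP; rewrite eq_sym -subr_eq0 addrK => /eqP->.
by move/(degf_eqNone deg): E => /eqP; rewrite oner_eq0.
Qed.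

Lemma degfN x : deg (- x) = deg x.
Proof.
have h : deg (-1) = Some 0.
  have := degfM deg (-1) (-1); rewrite mulrNN mulr1 degf1.
  case: (deg (-1)) => [a|] //= [] /esym/eqP.
  by rewrite -mulr2n mulrn_eq0 /= => /eqP->.
by rewrite -mulN1r degfM h; case: (deg x) => // a; rewrite /dadd add0r.
Qed.

Lemma dle_degM x y (i j n : int) : i + j = n ->
  dle (deg x) (Some i) -> dle (deg y) (Some j) -> dle (deg (x * y)) (Some n).
Proof.
move=> <-; rewrite degfM; case: (deg x) (deg y) => [a|] [b|] //=.
exact: lerD.
Qed.

Lemma dlt_degMl x y (i j n : int) : i + j = n ->
  dlt (deg x) (Some i) -> dle (deg y) (Some j) -> dlt (deg (x * y)) (Some n).
Proof.
move=> <-; rewrite degfM /dlt; case: (deg x) (deg y) => [a|] [b|] //=.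
by rewrite -!ltNge; apply: ltr_leD.
Qed.

End DegreeTheory.

Section AssociatedGraded.
Variables (B : comNzRingType) (deg : degree_function B).

Section Component.
Variable i : int.

Definition filt_le : {pred B} := fun x => dle (deg x) (Some i).

Lemma filt_le_zmod : zmod_closed filt_le.
Proof.
split=> [|x y]; rewrite !unfold_in /filt_le ?degf0 // => hx hy.
by apply: dle_trans (degfD deg x (- y)) _; rewrite degfN dle_dmax.
Qed.
HB.instance Definition _ := GRing.isZmodClosed.Build B filt_le filt_le_zmod.

(* B_i *)
Record filt : predArgType := Filt { filt_val : B; filtP : filt_val \in filt_le }.
HB.instance Definition _ := [isSub for filt_val].
HB.instance Definition _ := [Choice of filt by <:].
HB.instance Definition _ := [SubChoice_isSubZmodule of filt by <:].

Lemma filt_val_inj : injective filt_val.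
Proof. exact: (val_inj : injective (val : filt -> B)). Qed.
Lemma filt_valB (x y : filt) : filt_val (x - y) = filt_val x - filt_val y.
Proof. exact: (raddfB (val : filt -> B)). Qed.
Lemma filt_valD (x y : filt) : filt_val (x + y) = filt_val x + filt_val y.
Proof. exact: (raddfD (val : filt -> B)). Qed.
Lemma filt_val0 : filt_val 0 = 0.
Proof. exact: (raddf0 (val : filt -> B)). Qed.

(* B_{i^-}, as a subgroup of B_i *)
Definition filt_lt : {pred filt} := fun x => dlt (deg (filt_val x)) (Some i).

Lemma filt_lt_zmod : zmod_closed filt_lt.
Proof.
split=> [|x y]; rewrite !unfold_in /filt_lt ?filt_val0 ?degf0 // filt_valB => hx hy.
by apply: dle_lt_trans (degfD deg _ (- _)) _; rewrite degfN dlt_dmax.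
Qed.
HB.instance Definition _ := GRing.isZmodClosed.Build filt filt_lt filt_lt_zmod.

(* B_[i] = B_i / B_{i^-} *)
Definition gr_comp : zmodType := Quotient.quot filt_lt.

Definition gr_class (x : filt) : gr_comp := \pi_(Quotient.quot filt_lt) x.

Lemma gr_classE x y :
  gr_class x = gr_class y <-> dlt (deg (filt_val x - filt_val y)) (Some i).
Proof.
have -> : dlt (deg (filt_val x - filt_val y)) (Some i) = (x - y \in filt_lt).
  by rewrite unfold_in /filt_lt filt_valB.
by rewrite Quotient.idealrBE; split=> /eqP.
Qed.

Lemma gr_classK (u : gr_comp) : gr_class (repr u) = u.
Proof. exact: reprK. Qed.

Lemma gr_classD x y : gr_class (x + y) = gr_class x + gr_class y.
Proof. by rewrite /gr_class [LHS]raddfD. Qed.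

End Component.

Lemma filt_mul_subproof (i j n : int) (e : i + j = n)
    (x : filt i) (y : filt j) : filt_val x * filt_val y \in filt_le n.
Proof.
rewrite unfold_in /filt_le.
apply: dle_degM e _ _; [exact: (filtP x) | exact: (filtP y)].
Qed.

Definition filt_mul (i j n : int) (e : i + j = n) (x : filt i) (y : filt j) : filt n :=
  Filt (filt_mul_subproof e x y).

Lemma filt_mulE (i j n : int) (e : i + j = n) (x : filt i) (y : filt j) :
  filt_val (filt_mul e x y) = filt_val x * filt_val y.
Proof. by []. Qed.

(* The product (x + B_{i^-}) (y + B_{j^-}) = xy + B_{n^-}, where n = i + j;
   see [gr_mul_class] for independence of the representatives. *)
Definition gr_mul (i j n : int) (e : i + j = n) (u : gr_comp i) (v : gr_comp j)
  : gr_comp n := gr_class (filt_mul e (repr u) (repr v)).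

Lemma gr_mul_class (i j n : int) (e : i + j = n) (x : filt i) (y : filt j) :
  gr_mul e (gr_class x) (gr_class y) = gr_class (filt_mul e x y).
Proof.
rewrite /gr_mul; apply/gr_classE.
move: (gr_classK (gr_class x)) (gr_classK (gr_class y)).
move: (repr _) (repr _) => y' x' /gr_classE hx /gr_classE hy.
rewrite /=.
have -> : filt_val x' * filt_val y' - filt_val x * filt_val y =
    (filt_val x' - filt_val x) * filt_val y' + (filt_val y' - filt_val y) * filt_val x.
  by rewrite !mulrBl addrA [filt_val y' * _]mulrC subrK [filt_val y * _]mulrC.
apply: dle_lt_trans (degfD deg _ _) _; apply: dlt_dmax.
  by apply: dlt_degMl e hx _; apply: (filtP y').
by apply: dlt_degMl hy _; [rewrite addrC | apply: (filtP x)].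
Qed.

Lemma filt_one_subproof : 1 \in filt_le 0.
Proof. by rewrite unfold_in /filt_le degf1 /=. Qed.

Definition gr_one : gr_comp 0 := gr_class (Filt filt_one_subproof).

Lemma gr_mulDl (i j n : int) (e : i + j = n) (u u' : gr_comp i) (v : gr_comp j) :
  gr_mul e (u + u') v = gr_mul e u v + gr_mul e u' v.
Proof.
rewrite -(gr_classK u) -(gr_classK u') -(gr_classK v).
rewrite -gr_classD !gr_mul_class -gr_classD; congr gr_class.
by apply: filt_val_inj; rewrite filt_valD !filt_mulE filt_valD mulrDl.
Qed.

Lemma gr_mulC (i j n : int) (e : i + j = n) (e' : j + i = n)
  (u : gr_comp i) (v : gr_comp j) : gr_mul e u v = gr_mul e' v u.
Proof.
rewrite -(gr_classK u) -(gr_classK v) !gr_mul_class; congr gr_class.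
by apply: filt_val_inj; rewrite !filt_mulE mulrC.
Qed.

Lemma gr_mul1 (i : int) (e : 0 + i = i) (u : gr_comp i) : gr_mul e gr_one u = u.
Proof.
rewrite -[RHS]gr_classK -{1}(gr_classK u) gr_mul_class; congr gr_class.
by apply: filt_val_inj; rewrite !filt_mulE mul1r.
Qed.

Lemma gr_mulA (i j l m p n : int) (e1 : j + l = m) (e2 : i + m = n)
    (e3 : i + j = p) (e4 : p + l = n)
    (u : gr_comp i) (v : gr_comp j) (w : gr_comp l) :
  gr_mul e2 u (gr_mul e1 v w) = gr_mul e4 (gr_mul e3 u v) w.
Proof.
rewrite -(gr_classK u) -(gr_classK v) -(gr_classK w) !gr_mul_class.
by congr gr_class; apply: filt_val_inj; rewrite !filt_mulE mulrA.
Qed.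

Lemma gr_one_neq0 : gr_one != 0.
Proof.
have -> : 0 = gr_class (0 : filt 0) by rewrite /gr_class raddf0.
apply/eqP => /gr_classE; rewrite filt_val0 subr0 degf1.
by [].
Qed.

Definition gr_data : graded_data :=
  GradedData gr_mulDl gr_mulC gr_mul1 gr_mulA gr_one_neq0.

Definition Gr : comNzRingType := dsum gr_data.

End AssociatedGraded.

Section GrAlgebra.
Variables (k : fieldType) (B : comAlgType k) (deg : degree_function B).

Definition deg_trivial_on_scalars : Prop :=
  forall c : k, c != 0 -> deg c%:A = Some 0.

Hypothesis deg_k : deg_trivial_on_scalars.

Lemma scalar_filt_subproof (c : k) : c%:A \in filt_le deg 0.
Proof.
rewrite unfold_in /filt_le; case: (eqVneq c 0) => [->|/deg_k-> //].
by rewrite scale0r degf0.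
Qed.

(* The structure map k -> B_0 -> B_[0] -> Gr(B) of the k-algebra Gr(B). *)
Definition Gr_scalar (c : k) : Gr deg :=
  @dsingle (gr_data deg) 0
    (gr_class (Filt (scalar_filt_subproof c))).

(* Gr(B) and k[t, 1/t] are isomorphic as k-algebras. *)
Definition Gr_iso_laurent : Prop :=
  exists phi : {rmorphism Gr deg -> laurent k},
    bijective phi /\ forall c, phi (Gr_scalar c) = laurentC c.

End GrAlgebra.

(* Main.v *)
Require Import Defs.
From HB Require Import structures.
From mathcomp Require Import all_boot all_order all_algebra.
From mathcomp Require Import mpoly.
From mathcomp Require Import boolp classical_sets cardinality.
From mathcomp Require Import zify ring.

(** Let [n_j = (j+1)! - 1], let [w = sum_j t^(n_j)] with truncations
    [w_m = sum_(j < m) t^(n_j)], and embed [k[X,Y]] into [k((t))] by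
    [X |-> w / t], [Y |-> t]; the degree is minus the [t]-adic order.  Instead
    of power series we use the substitutions [X |-> w_m / t], [Y |-> t] into
    [k(t)]: for a fixed nonzero polynomial the order is eventually constant,
    because up to a power of [t] the image is a polynomial of degree [O(m!)],
    while its reduction modulo [t^(n_m)] (up to a fixed shift) no longer
    changes.  All residues lie in [k], and [X], [Y] have degrees [1] and [-1]
    with leading terms [1/t] and [t], so [Gr] is [k[t,1/t]].

    Let [D] be a derivation with [deg D] defined, and put
    [f_m = XY - w_m(Y)], of degree at most [-n_m].  Then
    [Y * D f_m = A - (t w_m')(Y) * D Y], with [A = Y * D(XY)], has degree at
    most [N - n_m].  Substituting [w_m], the polynomial obtained is of degree
    [O(m!) < n_m - N], so it vanishes.  Comparing top coefficients in [t], the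
    one of [A] is [n_(m-1)] times the one of [D Y] for all large [m]; both are
    independent of [m], so in characteristic zero [D Y = 0], then [D X = 0]. *)

Set Implicit Arguments.
Unset Strict Implicit.
Unset Printing Implicit Defensive.

Import Order.TTheory GRing.Theory Num.Theory.
Local Open Scope ring_scope.
Local Open Scope quotient_scope.

Local Notation "x %:F" := (@FracField.tofrac _ x).

(** * Order on degree values *)

Lemma dlexx (u : degval) : dle u u. Proof. by case: u => //= a. Qed.

Lemma dle_maxl (u v : degval) : dle u (dmax u v).
Proof. by rewrite /dmax; case: ifP => //; rewrite dlexx. Qed.

Lemma dle_maxr (u v : degval) : dle v (dmax u v).
Proof.
rewrite /dmax; case: ifP; rewrite ?dlexx //.
by case: u v => [a|] [b|] //=; lia.
Qed.

(** * Minus the order at zero, on polynomials and on their fractions *)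

Section OrderAtZero.
Variable k : fieldType.
Implicit Types (p q n d : {poly k}) (x y : {fraction {poly k}}).

Definition pdeg p : degval := if p == 0 then None else Some (- (mup 0 p)%:Z).

Lemma pdeg_nz p : p != 0 -> pdeg p = Some (- (mup 0 p)%:Z).
Proof. by rewrite /pdeg => /negbTE->. Qed.

Lemma pdegM p q : pdeg (p * q) = dadd (pdeg p) (pdeg q).
Proof.
rewrite /pdeg mulf_eq0; case: eqVneq => //= p0; case: eqVneq => //= q0.
by rewrite mupM // PoszD opprD.
Qed.

(** Turns degree bounds into divisibility by powers of the variable, the form in which they are
    added and compared with sizes. *)
Lemma pdeg_le p e : dle (pdeg p) (Some (- e%:Z)) = ('X^e %| p).
Proof.
rewrite /pdeg; case: eqVneq => [->|p0]; first by rewrite dvdp0.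
by rewrite /= lerN2 lez_nat mup_geq // polyC0 subr0.
Qed.

Lemma pdegD p q : dle (pdeg (p + q)) (dmax (pdeg p) (pdeg q)).
Proof.
have := dle_maxl (pdeg p) (pdeg q); have := dle_maxr (pdeg p) (pdeg q).
case: (eqVneq p 0) => [->|p0]; first by rewrite add0r.
case E: (dmax _ _) => [a|]; last by rewrite (pdeg_nz p0) /=.
(* The maximum is minus a natural number, as [pdeg_le] requires. *)
have [e ->] : exists e : nat, a = - e%:Z.
  move: E; rewrite /dmax (pdeg_nz p0) /pdeg.
  by case: ifP => [_|_ [<-]]; [case: ifP => // _ [<-] |]; eexists.
rewrite !pdeg_le => hq hp; exact: dvdp_add.
Qed.

Lemma frac_repr x : x = (\n_(repr x))%:F / (\d_(repr x))%:F.
Proof.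
have d0 : (\d_(repr x))%:F != 0 by rewrite tofrac_eq0 denom_ratioP.
apply: (mulIf d0); rewrite mulfVK // -{1}[x]reprK.
unlock FracField.tofrac; rewrite -[LHS]FracField.pi_mul.
apply/eqmodP; rewrite /= FracField.equivfE /FracField.mulf.
by rewrite !numden_Ratio ?mulf_neq0 ?oner_eq0 ?denom_ratioP // !mulr1 mulrC.
Qed.

Definition fdeg x : degval := dsub (pdeg \n_(repr x)) (pdeg \d_(repr x)).

(** Independence of the chosen representative: cross-multiplying two representations and applying
    [pdegM] equates the two differences. *)
Lemma fdeg_frac n d : d != 0 -> fdeg (n%:F / d%:F) = dsub (pdeg n) (pdeg d).
Proof.
move=> d0; set x := _ / _; rewrite /fdeg.
have r0 : \d_(repr x) != 0 by exact: denom_ratioP.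
have E : n * \d_(repr x) = \n_(repr x) * d.
  apply/eqP; rewrite -tofrac_eq !tofracM; apply/eqP.
  have := frac_repr x; rewrite {1}/x => /eqP.
  by rewrite eqr_div ?tofrac_eq0 // => /eqP.
have := congr1 pdeg E; rewrite !pdegM (pdeg_nz d0) (pdeg_nz r0).
case: (pdeg n) (pdeg \n_(repr x)) => [a|] [b|] //= [] h; congr Some; lia.
Qed.

Lemma fdeg_poly p : fdeg p%:F = pdeg p.
Proof.
rewrite -[p%:F]divr1 -tofrac1 fdeg_frac ?oner_neq0 // [pdeg 1]pdeg_nz ?oner_neq0 //.
by rewrite mupNroot ?root1 //; case: pdeg => //= a; congr Some; lia.
Qed.

Lemma fracP x : exists n d, d != 0 /\ x = n%:F / d%:F.
Proof. by exists \n_(repr x), \d_(repr x); split; [exact: denom_ratioP | exact: frac_repr]. Qed.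

Lemma fdeg_eqNone x : fdeg x = None <-> x = 0.
Proof.
have [n [d [d0 ->]]] := fracP x; rewrite fdeg_frac // (pdeg_nz d0) /pdeg.
case: eqVneq => [->|n0]; first by rewrite tofrac0 mul0r.
split=> // /eqP; rewrite mulf_eq0 invr_eq0 !tofrac_eq0 (negbTE n0) (negbTE d0) //.
Qed.

Lemma fdegM x y : fdeg (x * y) = dadd (fdeg x) (fdeg y).
Proof.
have [n [d [d0 ->]]] := fracP x; have [m [e [e0 ->]]] := fracP y.
rewrite mulf_div -!tofracM !fdeg_frac ?mulf_neq0 // !pdegM (pdeg_nz d0) (pdeg_nz e0).
case: (pdeg n) (pdeg m) => [a|] [b|] //=; congr Some; lia.
Qed.

Lemma fdegD x y : dle (fdeg (x + y)) (dmax (fdeg x) (fdeg y)).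
Proof.
have [n [d [d0 ->]]] := fracP x; have [m [e [e0 ->]]] := fracP y.
have d0' : d%:F != 0 by rewrite tofrac_eq0.
have e0' : e%:F != 0 by rewrite tofrac_eq0.
have -> : n%:F / d%:F + m%:F / e%:F = (n * e + m * d)%:F / (d * e)%:F.
  rewrite tofracD (tofracM n) (tofracM m) (tofracM d).
  move: d0' e0'; move: n%:F d%:F m%:F e%:F => a b c d'.
  exact: addf_div.
rewrite !fdeg_frac ?mulf_neq0 //.
have := pdegD (n * e) (m * d); rewrite !pdegM (pdeg_nz d0) (pdeg_nz e0) /dmax.
by case: (pdeg n) (pdeg m) (pdeg _) => [a|] [b|] [c|] //=; do ?case: ifP => /=; lia.
Qed.

Definition frac_degree : degree_function {fraction {poly k}} :=
  DegreeFunction fdeg_eqNone fdegM fdegD.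

End OrderAtZero.

(** * Properties that hold for all large indices *)

Definition eventually (P : nat -> Prop) : Prop := exists m0, forall m, (m0 <= m)%N -> P m.

Lemma eventually_and (P Q : nat -> Prop) :
  eventually P -> eventually Q -> eventually (fun m => P m /\ Q m).
Proof.
move=> [m0 h0] [m1 h1]; exists (maxn m0 m1) => m.
by rewrite geq_max => /andP[/h0 ? /h1 ?].
Qed.

Lemma eventually_mono (P Q : nat -> Prop) :
  (forall m, P m -> Q m) -> eventually P -> eventually Q.
Proof. by move=> PQ [m0 h]; exists m0 => m /h/PQ. Qed.

Lemma eventually_witness (P : nat -> Prop) : eventually P -> exists m, P m.
Proof. by move=> [m0 h]; exists m0; apply: h. Qed.

Lemma eventually_ge m0 : eventually (fun m => (m0 <= m)%N).
Proof. by exists m0. Qed.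

(** * Growth of the exponents *)

Definition gap (j : nat) : nat := (j.+1)`!.-1.

Lemma gapS j : (gap j).+1 = (j.+1)`!.
Proof. by rewrite /gap prednK ?fact_gt0. Qed.

Lemma gap_lt i j : (i < j)%N -> (gap i < gap j)%N.
Proof.
move=> ij; rewrite -ltnS !gapS; elim: j ij => // j IH.
rewrite ltnS leq_eqVlt => /predU1P[->|/IH{}IH].
  by rewrite [(j.+2)`!]factS ltn_Pmull ?fact_gt0.
by apply: leq_trans IH _; rewrite [(j.+2)`!]factS leq_pmull.
Qed.

Lemma gap_le i j : (i <= j)%N -> (gap i <= gap j)%N.
Proof. by rewrite leq_eqVlt => /predU1P[->//|/gap_lt/ltnW]. Qed.

(* [m`!] bounds the size of the truncation [lac m] below. *)
Lemma gap_dominates C : eventually (fun m => (C * m`! + C < gap m)%N).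
Proof.
(* For such [m], [gap m + 1 = (m + 1) * m!] is at least [(2 * C + 4) * m!], which exceeds
   [C * m! + C + 1]. *)
exists (2 * C + 3)%N => m hm; have := gapS m; rewrite factS => E.
have f1 : (0 < m`!)%N by rewrite fact_gt0.
nia.
Qed.

(** * Truncations of the lacunary series and substitution into polynomials *)

Section Lacunary.
Variable k : fieldType.
Implicit Types (Q : {poly {poly k}}) (p q r : {poly k}).

Definition lac m : {poly k} := \sum_(j < m) 'X^(gap j).

(* [t * d/dt] applied to [lac m]. *)
Definition lac_euler m : {poly k} := \sum_(j < m) (gap j)%:R *: 'X^(gap j).

Lemma lacS m : lac m.+1 = lac m + 'X^(gap m).
Proof. by rewrite /lac big_ord_recr. Qed.

Lemma lac_eulerS m : lac_euler m.+1 = lac_euler m + (gap m)%:R *: 'X^(gap m).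
Proof. by rewrite /lac_euler big_ord_recr. Qed.

Lemma size_lac_le m : (size (lac m) <= m`!)%N.
Proof.
elim: m => [|m IH]; first by rewrite /lac big_ord0 size_poly0.
rewrite lacS; apply: leq_trans (size_polyD _ _) _.
rewrite size_polyXn gapS geq_max leqnn andbT; apply: leq_trans IH _.
by rewrite factS leq_pmull.
Qed.

Lemma size_lac_euler_le m : (size (lac_euler m) <= m`!)%N.
Proof.
elim: m => [|m IH]; first by rewrite /lac_euler big_ord0 size_poly0.
rewrite lac_eulerS; apply: leq_trans (size_polyD _ _) _.
rewrite geq_max; apply/andP; split.
  by apply: leq_trans IH _; rewrite factS leq_pmull.
by apply: leq_trans (size_scale_leq _ _) _; rewrite size_polyXn gapS.
Qed.

Lemma size_lacS m : size (lac m.+1) = (m.+1)`!.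
Proof.
rewrite lacS; case: m => [|m]; first by rewrite /lac big_ord0 add0r size_polyXn gapS.
rewrite addrC size_polyDl size_polyXn gapS //.
by apply: leq_ltn_trans (size_lac_le _) _; rewrite ltn_fact.
Qed.

Lemma lead_coef_lacS m : lead_coef (lac m.+1) = 1.
Proof.
rewrite lacS; case: m => [|m].
  by rewrite /lac big_ord0 add0r lead_coefXn.
rewrite addrC lead_coefDl ?lead_coefXn // size_polyXn gapS.
by apply: leq_ltn_trans (size_lac_le _) _; rewrite ltn_fact.
Qed.

Lemma lead_coef_lac_eulerS (char0 : [pchar k] =i pred0) m :
  lead_coef (lac_euler m.+1) = (gap m)%:R.
Proof.
rewrite lac_eulerS; case: m => [|m].
  (* As [gap 0 = 0], the only term of [lac_euler 1] vanishes and both sides are zero. *)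
  by rewrite /lac_euler big_ord0 add0r scale0r lead_coef0.
have g0 : (gap m.+1)%:R != 0 :> k.
  rewrite (pcharf0P k).1 // -lt0n; exact: leq_ltn_trans (gap_lt (ltnSn m)).
rewrite addrC lead_coefDl ?lead_coefZ ?lead_coefXn ?mulr1 // size_scale // size_polyXn gapS.
by apply: leq_ltn_trans (size_lac_euler_le _) _; rewrite ltn_fact.
Qed.

Lemma dvd_lacB m M : (m <= M)%N -> 'X^(gap m) %| lac M - lac m.
Proof.
move=> mM; rewrite -(subnK mM); elim: (M - m)%N => [|d IH].
  by rewrite subrr dvdp0.
rewrite addSn lacS addrAC dvdp_add // dvdp_exp2l //.
by apply: gap_le; rewrite leq_addl.
Qed.

(** [Q] minus its value at [q] has the root [q]; evaluate the resulting factorization at [p]. *)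
Lemma horner_subr_dvd Q p q : p - q %| Q.[p] - Q.[q].
Proof.
have /factor_theorem[R E] : root (Q - (Q.[q])%:P) q.
  by rewrite rootE !hornerE subrr.
have := congr1 (fun S => S.[p]) E; rewrite !hornerE => ->.
by rewrite dvdp_mull.
Qed.

Lemma dvd_horner_lacB Q m M : (m <= M)%N -> 'X^(gap m) %| Q.[lac M] - Q.[lac m].
Proof. by move=> /dvd_lacB h; apply: dvdp_trans h (horner_subr_dvd _ _ _). Qed.

(** Each Horner step multiplies by [lac m], adding at most [m!] to the size, and the size of the
    added coefficient is absorbed because [m!] is positive. *)
Lemma size_horner_lac Q : exists C, forall m, (size (Q.[lac m]) <= C * m`!)%N.
Proof.
elim/poly_ind: Q => [|Q p [C IH]]; first by exists 0%N => m; rewrite horner0 size_poly0.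
exists (C + 1 + size p)%N => m; rewrite !hornerE.
have f1 : (0 < m`!)%N by rewrite fact_gt0.
apply: leq_trans (size_polyD _ _) _; rewrite geq_max; apply/andP; split; last by nia.
apply: leq_trans (size_polyMleq _ _) _.
apply: leq_trans (leq_pred _) _; apply: leq_trans (leq_add (IH m) (size_lac_le m)) _.
by rewrite !mulnDl mul1n leq_addr.
Qed.

(* As [size (lac m)] tends to infinity, the top coefficient of [Q] dominates. *)
Lemma lead_coef_horner_lac Q : exists2 l, l = 0 -> Q = 0 &
  eventually (fun m => lead_coef Q.[lac m] = l).
Proof.
elim/poly_ind: Q => [|Q p [l hl IH]].
  by exists 0 => //; exists 0%N => m _; rewrite horner0 lead_coef0.
have [Q0|Q0] := eqVneq Q 0.
  exists (lead_coef p) => [/eqP|].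
    by rewrite lead_coef_eq0 => /eqP->; rewrite Q0 mul0r add0r polyC0.
  by exists 0%N => m _; rewrite Q0 mul0r add0r hornerC.
exists l => [/hl/eqP|]; first by rewrite (negbTE Q0).
have [m0 h] := eventually_and IH (eventually_ge (size p).+1).
(* The threshold excludes [m = 0], where [lac] is zero instead of monic; beyond it [size p < m!], so
   [p] cannot reach the top term. *)
exists m0 => -[|m] /h[]//; rewrite !hornerE => E sz.
have lp : (size p < (m.+1)`!)%N by apply: leq_trans sz _; apply: fact_geq.
have QX0 : Q.[lac m.+1] != 0.
  by rewrite -lead_coef_eq0 E; apply: contraNneq Q0 => /hl->.
rewrite lead_coefDl ?lead_coefM ?lead_coef_lacS ?mulr1 //.
rewrite size_mul // ?size_lacS; last by rewrite -size_poly_gt0 size_lacS fact_gt0.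
by rewrite -size_poly_gt0 in QX0; rewrite -(prednK QX0) addSn; apply: leq_trans lp (leq_addl _ _).
Qed.

End Lacunary.

(** * Ultrametric comparison of degrees *)

Section DegreeGen.
Variables (B : comNzRingType) (deg : degree_function B).

Lemma degfB_le x y d : dle (deg x) d -> dle (deg y) d -> dle (deg (x - y)) d.
Proof.
by move=> hx hy; apply: dle_trans (degfD deg _ _) _; rewrite degfN dle_dmax.
Qed.

Lemma degf_near x y : dlt (deg (x - y)) (deg y) -> deg x = deg y.
Proof.
move=> h.
have h1 : dle (deg x) (deg y).
  rewrite -[x](subrK y); apply: dle_trans (degfD deg _ _) _.
  by rewrite dle_dmax ?dlexx ?dlt_le.
have h2 : dle (deg y) (deg x).
  apply: contraT => h2; have := degfD deg (y - x) x; rewrite subrK -opprB degfN.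
  by move=> h3; have := dlt_dmax h h2; rewrite /dlt h3.
move: h1 h2; case: (deg x) (deg y) => [a|] [b|] //= h1 h2.
by congr Some; apply/eqP; rewrite eq_le h1 h2.
Qed.

End DegreeGen.

(** * The degree function on k[X,Y], over any field with a degree extending [pdeg] *)

Section Embedding.
Variables (k K : fieldType) (iota : {rmorphism {poly k} -> K}).
Variable fd : degree_function K.
Hypothesis fd_iota : forall p, fd (iota p) = pdeg p.
Implicit Types (P : {mpoly k[2]}) (Q : {poly {poly k}}) (p : {poly k}).

Local Notation t := (iota 'X).

Definition lac_var m (i : 'I_2) : K := if i == 0 then iota (lac k m) / t else t.

Local Notation phi m := (mmap (iota \o polyC) (lac_var m)).

Lemma iota_eq0 p : (iota p == 0) = (p == 0).
Proof.
apply/eqP/eqP => [/(degf_eqNone fd)|->]; last exact: rmorph0.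
by rewrite fd_iota /pdeg; case: eqP.
Qed.

Lemma t_neq0 : t != 0. Proof. by rewrite iota_eq0 polyX_eq0. Qed.

Lemma phiX m : phi m 'X_0 = iota (lac k m) / t.
Proof. by rewrite mmapX mmap1U. Qed.

Lemma phiY m : phi m 'X_1 = t.
Proof. by rewrite mmapX mmap1U. Qed.

Lemma fdeg_tX n : fd (t ^+ n) = Some (- n%:Z).
Proof.
rewrite -rmorphXn /= fd_iota pdeg_nz ?expf_neq0 ?polyX_eq0 //.
by rewrite -['X]subr0 -polyC0 mup_XsubCX eqxx.
Qed.

(** A nonzero polynomial divisible by the power [gap m - C] of the variable has size above
    [gap m - C], hence above [C * m!]. *)
Lemma pdeg_small_eq0 C m p : (C * m`! + C < gap m)%N -> (size p <= C * m`!)%N ->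
  dle (pdeg p) (Some (C%:Z - (gap m)%:Z)) -> p = 0.
Proof.
have Cg : (C * m`! + C < gap m)%N -> (C <= gap m)%N.
  by move=> h; apply: leq_trans (ltnW h); rewrite leq_addl.
move=> hC sp; have {Cg} Cg := Cg hC; have -> : C%:Z - (gap m)%:Z = - (gap m - C)%N%:Z by lia.
rewrite pdeg_le => h; apply/eqP; apply: contraLR h => p0.
by apply/negP => /(dvdp_leq p0); rewrite size_polyXn ltnNge (leq_trans sp) //; lia.
Qed.

(** The monomial with exponents [a] is sent to [lac m] to the power [a 0] times [t] to the power
    [a 1 - a 0]; multiplying by [t ^+ N] clears negative exponents. [Q] does not depend on [m], so
    the estimates on [Q.[lac m]] apply uniformly. *)
Lemma phi_repr P : exists N Q, (Q = 0 -> P = 0) /\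
  forall m, t ^+ N * phi m P = iota Q.[lac k m].
Proof.
pose N := msize P.
pose Q : {poly {poly k}} :=
  \sum_(a <- msupp P) (P@_a *: 'X^(N + a 1%R - a 0%R)) *: 'X^(a 0%R).
(* This makes the truncated subtraction in the exponents of [Q] exact. *)
have le_N (a : 'X_{1..2}) : a \in msupp P -> (a 0%R <= N)%N.
  move=> /msize_mdeg_lt/ltnW; apply: leq_trans.
  by rewrite mdegE (bigD1 0) //= leq_addr.
exists N, Q; split=> [Q0|m].
  apply/eqP; rewrite -msupp_eq0; case E: (msupp P) => [//|a s].
  have aP : a \in msupp P by rewrite E mem_head.
  (* The pair of exponents determines the monomial, so this coefficient of [Q] is exactly [P@_a]. *)
  have := congr1 (fun S : {poly {poly k}} => S`_(a 0%R)`_(N + a 1%R - a 0%R)) Q0.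
  rewrite !coef0 /Q !coef_sum (bigD1_seq a) ?msupp_uniq //= big1_seq.
    rewrite !coefZ !coefXn eqxx mulr1 coefZ coefXn eqxx mulr1 addr0 => /eqP.
    by rewrite -[_ == 0]negbK -mcoeff_msupp aP.
  move=> b /andP[ba bP]; rewrite coefZ coefXn; case: eqP => [e0|]; last by rewrite mulr0 coef0.
  rewrite mulr1 coefZ coefXn; case: eqP => [e1|]; last by rewrite mulr0.
  case/eqP: ba; apply/mnmP => i.
  have := le_N _ aP; have := le_N _ bP.
  have /orP[/eqP->//|/eqP->] : (i == 0) || (i == 1) by case: i => -[|[|]].
  by rewrite -e0 in e1 *; lia.
rewrite /mmap mulr_sumr /Q horner_sum rmorph_sum /=.
apply: eq_big_seq => a /le_N aN.
rewrite !hornerE /mmap1 big_ord_recl big_ord1 /lac_var /=.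
rewrite -mul_polyC !rmorphM !rmorphXn /=.
have -> : a (lift ord0 ord0) = a 1%R by congr (a _); apply: val_inj.
have : t ^+ N * t ^+ (a 1%R) = t ^+ (N + a 1%R - a 0%R) * t ^+ (a 0%R).
  by rewrite -!exprD subnK // (leq_trans aN) ?leq_addr.
have : t ^+ (a 0%R) != 0 by rewrite expf_neq0 ?t_neq0.
rewrite expr_div_n.
move: (t ^+ a 0%R) (t ^+ N) (t ^+ (N + a 1%R - a 0%R)) (t ^+ a 1%R).
move: (iota (lac k m) ^+ a 0%R) (iota (P@_a)%:P) => v c x y z u x0 E.
have -> : y * c * (v / x * u) = c * v * (y * u) / x by field.
by rewrite E; field.
Qed.

Lemma fdeg_phi P N Q m : t ^+ N * phi m P = iota Q.[lac k m] ->
  dadd (Some (- N%:Z)) (fd (phi m P)) = pdeg Q.[lac k m].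
Proof. by move=> E; rewrite -fd_iota -E degfM fdeg_tX. Qed.

Lemma phi_close P : exists N : nat, forall m M, (m <= M)%N ->
  dle (fd (phi M P - phi m P)) (Some (N%:Z - (gap m)%:Z)).
Proof.
have [N [Q [_ E]]] := phi_repr P; exists N => m M /(dvd_horner_lacB Q).
rewrite -pdeg_le -fd_iota rmorphB -!E -mulrBr degfM fdeg_tX.
by case: (fd _) => [a|] //=; lia.
Qed.

(** Otherwise, for some large [m], [Q.[lac m]] has size [O(m!)] but order at least [gap m] up to a
    constant, so it vanishes; its leading coefficient [l] is then zero, which forces [Q = 0] and
    [P = 0]. *)
Lemma phi_far P : P != 0 -> forall N : nat,
  eventually (fun m => dlt (Some (N%:Z - (gap m)%:Z)) (fd (phi m P))).
Proof.
move=> P0 M; have [N [Q [Q0 E]]] := phi_repr P.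
have [l l0 hl] := lead_coef_horner_lac Q; have [C sC] := size_horner_lac Q.
apply: eventually_mono (eventually_and hl (gap_dominates (C + N + M)%N)) => m [hm gm].
apply/negP => h; case/eqP: P0; apply/Q0/l0; rewrite -hm.
rewrite (@pdeg_small_eq0 (C + N + M) m Q.[lac k m]) ?lead_coef0 //.
  by apply: leq_trans (sC m) _; rewrite leq_mul2r -addnA leq_addr orbT.
by rewrite -(fdeg_phi (E m)); move: h; case: (fd _) => [a|] //=; lia.
Qed.

(** From some [m0] on, the error bounded by [phi_close] lies strictly below the degree at [m0], so
    [degf_near] applies. *)
Lemma phi_stable P : exists d, eventually (fun m => fd (phi m P) = d).
Proof.
have [->|P0] := eqVneq P 0.
  by exists None; exists 0%N => m _; rewrite rmorph0 degf0.
have [N hN] := phi_close P; have [m0 h0] := phi_far P0 N.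
exists (fd (phi m0 P)), m0 => m mm0; apply: degf_near.
by apply: dle_lt_trans (hN _ _ mm0) (h0 _ _).
Qed.

Definition lac_deg_fun P : degval := projT1 (cid (phi_stable P)).

Lemma lac_deg_funP P : eventually (fun m => fd (phi m P) = lac_deg_fun P).
Proof. by rewrite /lac_deg_fun; case: cid. Qed.

(** For nonzero [P], the strict lower bound of [phi_far] rules out the value [None]. *)
Lemma lac_deg_eqNone P : lac_deg_fun P = None <-> P = 0.
Proof.
split=> [h|->].
  apply/eqP; apply: contraPT h => P0 h.
  have [m []] := eventually_witness (eventually_and (lac_deg_funP P) (phi_far P0 0)).
  by rewrite h => ->.
by have [m <-] := eventually_witness (lac_deg_funP 0); rewrite rmorph0 degf0.
Qed.

Lemma lac_degM P P' : lac_deg_fun (P * P') = dadd (lac_deg_fun P) (lac_deg_fun P').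
Proof.
have [m [<- [<- <-]]] := eventually_witness (eventually_and (lac_deg_funP (P * P'))
  (eventually_and (lac_deg_funP P) (lac_deg_funP P'))).
by rewrite rmorphM degfM.
Qed.

Lemma lac_degD P P' :
  dle (lac_deg_fun (P + P')) (dmax (lac_deg_fun P) (lac_deg_fun P')).
Proof.
have [m [<- [<- <-]]] := eventually_witness (eventually_and (lac_deg_funP (P + P'))
  (eventually_and (lac_deg_funP P) (lac_deg_funP P'))).
by rewrite rmorphD degfD.
Qed.

Definition lac_deg : degree_function {mpoly k[2]} :=
  DegreeFunction lac_deg_eqNone lac_degM lac_degD.

Lemma lac_degP P : eventually (fun m => fd (phi m P) = lac_deg P).
Proof. exact: lac_deg_funP. Qed.

Lemma phiC m c : phi m c%:A = iota c%:P.
Proof. by rewrite alg_mpolyC mmapC. Qed.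

Lemma fdeg_const c : c != 0 -> fd (iota c%:P) = Some 0.
Proof.
by move=> c0; rewrite fd_iota pdeg_nz ?polyC_eq0 // mupNroot ?rootC.
Qed.

Lemma lac_deg_scalars : deg_trivial_on_scalars lac_deg.
Proof.
move=> c c0; have [m <-] := eventually_witness (lac_degP c%:A).
by rewrite phiC fdeg_const.
Qed.

End Embedding.

(** * Derivations on powers and on generators *)

Section Derivations.
Variables (B : comNzRingType) (D : {additive B -> B}).
Hypothesis derD : is_derivation D.

Lemma derivation1 : D 1 = 0.
Proof.
by have := derD 1 1; rewrite !mulr1 mul1r => /eqP; rewrite -subr_eq0 opprD addNKr oppr_eq0 => /eqP.
Qed.

(** The extra factor [x] avoids the exponent [n - 1], so that [n = 0] is no exception; this is why
    [D (lac_error m)] is later multiplied by [Y]. *)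
Lemma derivationX x n : x * D (x ^+ n) = n%:R * x ^+ n * D x.
Proof.
elim: n => [|n IH]; first by rewrite derivation1 mulr0 mul0r mul0r.
by rewrite exprS derD mulrDr IH -natr1; ring.
Qed.

End Derivations.

Lemma mpoly_gen_ind n (R : nzRingType) (P : {mpoly R[n]} -> Prop) :
  (forall c, P c%:MP) -> (forall i, P 'X_i) ->
  (forall p q, P p -> P q -> P (p + q)) -> (forall p q, P p -> P q -> P (p * q)) ->
  forall p, P p.
Proof.
move=> PC PX PD PM; have P0 : P 0 by rewrite -mpolyC0.
elim/mpolyind => // c m p _ _; apply: PD; rewrite -mul_mpolyC; apply: (PM) => //.
rewrite mpolyXE_id; apply: (big_rec P); first by rewrite -mpolyC1.
move=> i q _ Pq; apply: (PM) => //; elim: (m i) => [|d IH]; first by rewrite expr0 -mpolyC1.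
by rewrite exprS; apply: (PM).
Qed.

Lemma derivation_eq0 n (R : comNzRingType) (D : {linear {mpoly R[n]} -> {mpoly R[n]}}) :
  is_derivation D -> (forall i, D 'X_i = 0) -> forall p, D p = 0.
Proof.
move=> derD DX; elim/mpoly_gen_ind => [c|//|p q hp hq|p q hp hq].
- by rewrite -alg_mpolyC linearZ /= (derivation1 derD) scaler0.
- by rewrite raddfD /= hp hq addr0.
- by rewrite derD hp hq mul0r mulr0 addr0.
Qed.

(** * Derivations whose degree is defined *)

Section DegreeOfDerivations.
Variables (k K : fieldType) (iota : {rmorphism {poly k} -> K}).
Variable fd : degree_function K.
Hypothesis fd_iota : forall p, fd (iota p) = pdeg p.
Hypothesis char0 : [pchar k] =i pred0.
Implicit Types (P : {mpoly k[2]}) (Q : {poly {poly k}}) (p : {poly k}).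

Local Notation t := (iota 'X).
Local Notation phi m := (mmap (iota \o polyC) (lac_var iota m)).
Local Notation deg := (lac_deg fd_iota).
Local Notation X := ('X_0 : {mpoly k[2]}).
Local Notation Y := ('X_1 : {mpoly k[2]}).

Definition lac_error m : {mpoly k[2]} := X * Y - \sum_(j < m) Y ^+ gap j.

Definition euler_sum m : {mpoly k[2]} := \sum_(j < m) (gap j)%:R * Y ^+ gap j.

Lemma phi_error m M : phi M (lac_error m) = iota (lac k M - lac k m).
Proof.
rewrite rmorphB rmorphM /= phiX phiY divfK ?(t_neq0 fd_iota) // rmorphB /=; congr (_ - _).
rewrite /lac !rmorph_sum; apply: eq_bigr => j _.
by rewrite !rmorphXn /= phiY.
Qed.

Lemma phi_euler_sum m M : phi M (euler_sum m) = iota (lac_euler k m).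
Proof.
rewrite /lac_euler !rmorph_sum; apply: eq_bigr => j _.
by rewrite rmorphM rmorphXn /= phiY rmorph_nat -mul_polyC rmorphM rmorphXn polyC_natr rmorph_nat.
Qed.

(** Its image under the next substitution is the single power of [t] with exponent [gap m]. *)
Lemma lac_error_neq0 m : lac_error m != 0.
Proof.
apply: contraTneq isT => E; have := phi_error m m.+1.
rewrite E rmorph0 lacS addrC addKr => /esym/eqP.
by rewrite (iota_eq0 fd_iota) -size_poly_eq0 size_polyXn.
Qed.

Lemma deg_lac_error m : dle (deg (lac_error m)) (Some (- (gap m)%:Z)).
Proof.
have [M [<- mM]] := eventually_witness (eventually_and (lac_degP fd_iota (lac_error m)) (eventually_ge m)).
by rewrite phi_error fd_iota pdeg_le dvd_lacB.
Qed.

Lemma degY : deg Y = Some (-1).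
Proof.
have [M <-] := eventually_witness (lac_degP fd_iota Y).
by rewrite phiY -[t]expr1 (fdeg_tX fd_iota).
Qed.

Section Main.
Variable D : {linear {mpoly k[2]} -> {mpoly k[2]}}.
Hypothesis derD : is_derivation D.

Local Notation A := (Y * (D X * Y + X * D Y)).

Lemma derivation_lac_error m : Y * D (lac_error m) = A - euler_sum m * D Y.
Proof.
rewrite raddfB /= derD mulrBr; congr (_ - _).
rewrite raddf_sum mulr_sumr mulr_suml; apply: eq_bigr => j _.
exact: derivationX.
Qed.

Lemma deg_defined_bound : deg_defined deg D ->
  exists N : nat, forall m, dle (deg (A - euler_sum m * D Y)) (Some (N%:Z - (gap m)%:Z)).
Proof.
move=> [u _ hu].
(* The greatest shift may be negative or [None]; any natural upper bound will do. *)
have [N hN] : exists N : nat, dle u (Some N%:Z).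
  by case: (u) => [c|]; [exists `|c|%N => /=; lia | exists 0%N].
exists N => m; rewrite -derivation_lac_error degfM degY.
have : dle (dsub (deg (D (lac_error m))) (deg (lac_error m))) (Some N%:Z).
  by apply: dle_trans hN; apply: hu; exists (lac_error m) => //; exact: lac_error_neq0.
have := deg_lac_error m; case E: (deg (lac_error m)) => [d|]; last first.
  by move/(degf_eqNone deg): E => /eqP; rewrite (negbTE (lac_error_neq0 m)).
by case: (deg _) => [e|] //=; lia.
Qed.

(** The degree is computed by [phi M] for large [M]. Replacing [phi M] by [phi m] costs errors
    controlled by [phi_close], with constants independent of [m], and the image of [euler_sum m] is
    the same for all [M]. *)
Lemma phi_bound : deg_defined deg D -> exists N : nat, forall m,
  dle (fd (phi m A - iota (lac_euler k m) * phi m (D Y))) (Some (N%:Z - (gap m)%:Z)).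
Proof.
move=> /deg_defined_bound[N1 h1].
have [N2 h2] := phi_close fd_iota A; have [N3 h3] := phi_close fd_iota (D Y).
exists (N1 + N2 + N3)%N => m.
have [M [hM mM]] := eventually_witness (eventually_and
  (lac_degP fd_iota (A - euler_sum m * D Y)) (eventually_ge m)).
have -> : phi m A - iota (lac_euler k m) * phi m (D Y) =
   phi M (A - euler_sum m * D Y) - ((phi M A - phi m A)
     - iota (lac_euler k m) * (phi M (D Y) - phi m (D Y))).
  rewrite rmorphB [X in _ = X - _ - _]/= (rmorphM _ (euler_sum m)) /= phi_euler_sum.
  move: (phi M A) (phi m A) (phi M (D Y)) (phi m (D Y)) (iota _) => a b c d e.
  by ring.
have weaken (u : degval) (n : nat) : (n <= N1 + N2 + N3)%N ->
    dle u (Some (n%:Z - (gap m)%:Z)) -> dle u (Some ((N1 + N2 + N3)%N%:Z - (gap m)%:Z)).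
  by move=> hn; case: u => [a|] //=; lia.
apply: degfB_le; first by rewrite hM; apply: weaken (h1 m); lia.
apply: degfB_le; first by apply: weaken (h2 _ _ mM); lia.
rewrite degfM; apply: weaken (_ : (N3 <= _)%N) _; first by lia.
have := h3 _ _ mM; have : dle (fd (iota (lac_euler k m))) (Some 0).
  by rewrite fd_iota (pdeg_le _ 0) dvd1p.
by case: (fd _) (fd _) => [a|] [b|] //=; lia.
Qed.

Lemma deg_defined_gen0 : deg_defined deg D -> D X = 0 /\ D Y = 0.
Proof.
move=> /phi_bound[N hN].
have [NA [QA [QA0 EA]]] := phi_repr fd_iota A.
have [NB [QB [QB0 EB]]] := phi_repr fd_iota (D Y).
have [CA sA] := size_horner_lac QA; have [CB sB] := size_horner_lac QB.
have [lA lA0 hA] := lead_coef_horner_lac QA.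
have [lB lB0 hB] := lead_coef_horner_lac QB.
(* [C] dominates the sizes of both sides of the identity below, where the summand 1 pays for
   [lac_euler], as well as the shift [N] of the order of their difference. *)
pose C := (NA + NB + CA + CB + N + 1)%N.
have Ev : eventually (fun m =>
    'X^NB * QA.[lac k m] = 'X^NA * lac_euler k m * QB.[lac k m]).
  apply: eventually_mono (gap_dominates C) => m gm.
  apply/eqP; rewrite -subr_eq0; apply/eqP; apply: (pdeg_small_eq0 gm).
    have f1 : (0 < m`!)%N by rewrite fact_gt0.
    have CE : (C * m`! = NA * m`! + NB * m`! + CA * m`! + CB * m`! + N * m`! + m`!)%N.
      by rewrite /C !mulnDl mul1n.
    have n1 : (NB <= NB * m`!)%N by rewrite leq_pmulr.
    have n2 : (NA <= NA * m`!)%N by rewrite leq_pmulr.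
    apply: leq_trans (size_polyD _ _) _; rewrite size_polyN geq_max.
    apply/andP; split; rewrite -?mulrA; apply: leq_trans (size_polyMleq _ _) _;
      rewrite size_polyXn addSn /=.
      by apply: leq_trans (leq_add n1 (sA m)) _; rewrite CE; lia.
    have h : (size (lac_euler k m * QB.[lac k m])%R <= m`! + CB * m`!)%N.
      apply: leq_trans (size_polyMleq _ _) _; apply: leq_trans (leq_pred _) _.
      exact: leq_add (size_lac_euler_le k m) (sB m).
    by apply: leq_trans (leq_add n2 h) _; rewrite CE; lia.
  rewrite -fd_iota rmorphB !rmorphM !rmorphXn /= -EA -EB.
  have -> : t ^+ NB * (t ^+ NA * phi m A) -
      t ^+ NA * iota (lac_euler k m) * (t ^+ NB * phi m (D Y)) =
      t ^+ (NA + NB) * (phi m A - iota (lac_euler k m) * phi m (D Y)).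
    rewrite exprD; move: (phi m A) (phi m (D Y)) (iota _) (t ^+ _) (t ^+ _) => a b c d e.
    by ring.
  rewrite degfM (fdeg_tX fd_iota); move: (hN m); case: (fd _) => [a|] //=.
  by rewrite /C; lia.
have [m0 h] := eventually_and Ev (eventually_and hA hB).
(* The identity is used at [m.+1], where [lac_euler] has leading coefficient [gap m]. *)
have L m : (m0 <= m)%N -> lA = (gap m)%:R * lB.
  move=> /leqW /h [/(congr1 lead_coef) E [<- <-]]; move: E.
  by rewrite !lead_coefM !lead_coefXn !mul1r (lead_coef_lac_eulerS char0).
(* Two consecutive values of [m] give [lA] as different multiples of [lB], and the difference of the
   factors is nonzero in characteristic zero. *)
have lB_eq0 : lB = 0.
  have := L _ (leqnSn m0); rewrite (L _ (leqnn m0)) => /eqP.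
  have g := gap_lt (ltnSn m0).
  rewrite -subr_eq0 -mulrBl mulf_eq0 => /orP[|/eqP//].
  rewrite -opprB oppr_eq0 -natrB ?(ltnW g) // (pcharf0P k).1 // subn_eq0 leqNgt g //.
have b0 : D Y = 0 by apply/QB0/lB0.
have : A = 0 by apply/QA0/lA0; rewrite (L _ (leqnn m0)) lB_eq0 mulr0.
have Y0 : Y != 0 by apply: contraTneq isT => Y0; have := degY; rewrite Y0 degf0.
rewrite b0 mulr0 addr0 => /eqP; rewrite !mulf_eq0 (negbTE Y0) orbF /= => /eqP.
by [].
Qed.

End Main.

Lemma lac_deg_defined (D : {linear {mpoly k[2]} -> {mpoly k[2]}}) :
  is_derivation D -> deg_defined deg D <-> forall P, D P = 0.
Proof.
move=> derD; split=> [/(deg_defined_gen0 derD)[a b]|D0].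
  apply: derivation_eq0 => // i.
  by have /orP[/eqP->|/eqP->] : (i == 0) || (i == 1) by case: i => -[|[|]].
(* For the zero derivation every shift is [None], attained at 1. *)
exists None => [|u [x _ ->]]; last by rewrite D0 degf0.
by exists 1; rewrite ?oner_neq0 // D0 degf0.
Qed.

End DegreeOfDerivations.

(** * Ring isomorphisms of direct sums from isomorphisms of components *)

Section GradedIso.
Variables (M N : graded_data) (f : forall i, M i -> N i).
Hypothesis fD : forall i (u v : M i), f (u + v) = f u + f v.
Hypothesis f1 : f (gone M) = gone N.
Hypothesis fM : forall (i j n : int) (e : i + j = n) (u : M i) (v : M j),
  f (gmul e u v) = gmul e (f u) (f v).
Hypothesis f_inj : forall i, injective (@f i).
Hypothesis f_surj : forall i (v : N i), exists u, f u = v.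

Lemma graded_map0 i : f (0 : M i) = 0.
Proof. by apply: (addrI (f (0 : M i))); rewrite -fD !addr0. Qed.

Lemma graded_map_fin (x : dsum M) : finite_set [set i | f (x i) != 0].
Proof.
apply: sub_finite_set (dcoef_fin x) => i /=.
by apply: contraNN => /eqP->; rewrite graded_map0.
Qed.

Definition graded_map (x : dsum M) : dsum N := DSum (graded_map_fin x).

Lemma graded_map_zmod : zmod_morphism graded_map.
Proof.
have fN i (u : M i) : f (- u) = - f u.
  by apply: (addrI (f u)); rewrite -fD !subrr graded_map0.
by move=> x y; apply: dsum_ext => i; rewrite dcoefD dcoefN /= fD fN.
Qed.

HB.instance Definition _ :=
  GRing.isZmodMorphism.Build (dsum M) (dsum N) graded_map graded_map_zmod.

Lemma graded_map_single i (u : M i) : graded_map (dsingle u) = dsingle (f u).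
Proof.
apply: dsum_ext => j /=; have [e|ij] := eqVneq i j.
  by subst j; rewrite !dsingle_funE.
by rewrite !dsingle_funN ?graded_map0.
Qed.

Lemma graded_map_monoid : monoid_morphism graded_map.
Proof.
split=> [|x y]; first by rewrite graded_map_single f1.
apply: dsum_ext => n; have [s us hs] := dsum_seq x.
have hs' i : i \notin s -> graded_map x i = 0 by move=> /hs /= ->; rewrite graded_map0.
rewrite (dsummulE _ _ us hs') /= (dsummul_funE _ _ us hs).
by rewrite (big_morph _ (@fD n) (graded_map0 n)); apply: eq_bigr => i _; rewrite fM.
Qed.

HB.instance Definition _ :=
  GRing.isMonoidMorphism.Build (dsum M) (dsum N) graded_map graded_map_monoid.

Definition graded_rmorphism : {rmorphism dsum M -> dsum N} := graded_map.

(** Preimages are chosen in each component; injectivity makes the preimage of zero zero, which keeps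
    supports finite. *)
Lemma graded_map_bij : bijective graded_map.
Proof.
pose g i (v : N i) : M i := projT1 (cid (f_surj v)).
have gK i (v : N i) : f (g i v) = v by rewrite /g; case: cid.
have fin (y : dsum N) : finite_set [set i | g i (y i) != 0].
  apply: sub_finite_set (dcoef_fin y) => i /=.
  by apply: contraNN => /eqP E; apply/eqP/f_inj; rewrite gK E graded_map0.
exists (fun y => DSum (fin y)) => x; apply: dsum_ext => i /=; last exact: gK.
by apply: f_inj; rewrite gK.
Qed.

End GradedIso.

(** * Leading coefficients and the associated graded ring *)

Section LeadingCoefficient.
Variables (k K : fieldType) (iota : {rmorphism {poly k} -> K}).
Variable fd : degree_function K.
Hypothesis fd_iota : forall p, fd (iota p) = pdeg p.
Implicit Types (P : {mpoly k[2]}) (x y : K) (c : k) (i j n : int).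

Local Notation t := (iota 'X).
Local Notation phi m := (mmap (iota \o polyC) (lac_var iota m)).
Local Notation deg := (lac_deg fd_iota).
Local Notation X := ('X_0 : {mpoly k[2]}).
Local Notation Y := ('X_1 : {mpoly k[2]}).

Lemma fdeg_tXz i : fd (t ^ i) = Some (- i).
Proof.
have t0 := t_neq0 fd_iota; case: i => d; first exact: (fdeg_tX fd_iota).
have := degf1 fd; rewrite -(mulVf (expf_neq0 d.+1 t0)) degfM (fdeg_tX fd_iota).
rewrite NegzE -[t ^ _]/(t ^- d.+1).
by case: (fd _) => [a|] //= [] h; congr Some; lia.
Qed.

Lemma fdeg_le0 (p : {poly k}) : dle (fd (iota p)) (Some 0).
Proof. by rewrite fd_iota (pdeg_le _ 0) dvd1p. Qed.

(* [x] has leading term [c * t^-i] in degree [i]; [c] may vanish. *)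
Definition has_lead i x c : Prop := dlt (fd (x - iota c%:P * t ^ (- i))) (Some i).

Lemma fdeg_term_le i c : dle (fd (iota c%:P * t ^ (- i))) (Some i).
Proof.
by apply: (@dle_degM _ _ _ _ 0 i) => //; rewrite ?add0r ?fdeg_le0 // fdeg_tXz opprK dlexx.
Qed.

Lemma has_lead_le i x c : has_lead i x c -> dle (fd x) (Some i).
Proof.
move=> h; rewrite -[x](subrK (iota c%:P * t ^ (- i))).
by apply: dle_trans (degfD _ _ _) _; rewrite dle_dmax ?fdeg_term_le // dlt_le.
Qed.

Lemma has_lead0 i x : has_lead i x 0 <-> dlt (fd x) (Some i).
Proof. by rewrite /has_lead polyC0 rmorph0 mul0r subr0. Qed.

Lemma has_leadB i x y c d :
  has_lead i x c -> has_lead i y d -> has_lead i (x - y) (c - d).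
Proof.
rewrite /has_lead polyCB rmorphB /= => hx hy.
have -> : x - y - (iota c%:P - iota d%:P) * t ^ (- i) =
  (x - iota c%:P * t ^ (- i)) - (y - iota d%:P * t ^ (- i)) by ring.
by apply: dle_lt_trans (degfD _ _ _) _; rewrite degfN dlt_dmax.
Qed.

Lemma has_lead_near i x y c :
  has_lead i x c -> dlt (fd (y - x)) (Some i) -> has_lead i y c.
Proof.
move=> hx /has_lead0 hyx.
have -> : y = (y - x) - (0 - x) by ring.
have -> : c = 0 - (0 - c) by ring.
by apply: (has_leadB hyx); apply: has_leadB hx; apply/has_lead0; rewrite degf0.
Qed.

(** Otherwise [c - d] times a power of [t] would have degree exactly [i] and also less than [i]. *)
Lemma has_lead_uniq i x c d : has_lead i x c -> has_lead i x d -> c = d.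
Proof.
move=> hc hd; have := has_leadB hc hd; rewrite /has_lead subrr sub0r degfN.
apply: contraPeq => cd; rewrite degfM fdeg_tXz (fdeg_const fd_iota) ?subr_eq0 //.
by rewrite /dlt /= add0r opprK lexx.
Qed.

Lemma has_leadM i j n x y c d : i + j = n ->
  has_lead i x c -> has_lead j y d -> has_lead n (x * y) (c * d).
Proof.
move=> ijn hx hy; rewrite /has_lead.
have -> : x * y - iota (c * d)%:P * t ^ (- n) =
    (x - iota c%:P * t ^ (- i)) * y + (y - iota d%:P * t ^ (- j)) * (iota c%:P * t ^ (- i)).
  rewrite -ijn opprD expfzDr ?(t_neq0 fd_iota) // polyCM rmorphM /=; ring.
apply: dle_lt_trans (degfD _ _ _) _; apply: dlt_dmax.
  exact: dlt_degMl ijn hx (has_lead_le hy).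
by apply: dlt_degMl hy (fdeg_term_le _ _); rewrite addrC.
Qed.

(** If [i > N] then [x] has degree below [i] and [c = 0]. Otherwise write [N = i + e]: the power [e]
    of the variable divides [p], and [c] is the constant term of the quotient [q]. *)
Lemma has_lead_exists x (N : nat) p i :
  t ^+ N * x = iota p -> dle (fd x) (Some i) -> exists c, has_lead i x c.
Proof.
move=> E hx; have tN0 : t ^+ N != 0 by rewrite expf_neq0 ?(t_neq0 fd_iota).
have degE : pdeg p = dadd (Some (- N%:Z)) (fd x) by rewrite -fd_iota -E degfM (fdeg_tX fd_iota).
have [iN|Ni] := leP i N%:Z; last first.
  exists 0; apply/has_lead0; have := fdeg_le0 p; rewrite fd_iota degE.
  by case: (fd x) => [a|] //; rewrite /dlt /=; lia.
have [e Ne] : exists e : nat, N%:Z = i + e%:Z by exists `|N%:Z - i|%N; lia.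
have /dvdpP[q pq] : 'X^e %| p.
  by rewrite -pdeg_le degE; move: hx; case: (fd x) => [a|] //=; lia.
have /factor_theorem[r] : root (q - (q.[0])%:P) 0 by rewrite rootE !hornerE subrr.
rewrite polyC0 subr0 => qr; exists q.[0].
have tz : t ^+ N * t ^ (- i) = t ^+ e.
  by rewrite !exprnP -expfzDr ?(t_neq0 fd_iota) // Ne; congr (_ ^ _); lia.
have : t ^+ N * (x - iota (q.[0])%:P * t ^ (- i)) = iota (r * 'X^(e.+1)).
  by rewrite mulrBr E mulrCA tz pq exprS mulrA -qr mulrBl rmorphB !rmorphM !rmorphXn.
move=> /(congr1 fd); rewrite degfM (fdeg_tX fd_iota) /has_lead fd_iota.
have : dle (pdeg (r * 'X^(e.+1))) (Some (- (e.+1)%:Z)) by rewrite pdeg_le dvdp_mull.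
by case: (fd _) (pdeg _) => [a|] [b|] //= h [] h2; rewrite /dlt /=; lia.
Qed.

Definition has_lc i P c : Prop := eventually (fun m => has_lead i (phi m P) c).

Lemma has_lcB i P P' c d : has_lc i P c -> has_lc i P' d -> has_lc i (P - P') (c - d).
Proof.
move=> h h'; apply: eventually_mono (eventually_and h h') => m [hm hm'].
by rewrite rmorphB; apply: has_leadB.
Qed.

Lemma has_lcM i j n P P' c d : i + j = n ->
  has_lc i P c -> has_lc j P' d -> has_lc n (P * P') (c * d).
Proof.
move=> ijn h h'; apply: eventually_mono (eventually_and h h') => m [hm hm'].
by rewrite rmorphM; apply: has_leadM ijn hm hm'.
Qed.

Lemma has_lc_uniq i P c d : has_lc i P c -> has_lc i P d -> c = d.
Proof.
move=> h h'; have [m [hm hm']] := eventually_witness (eventually_and h h').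
exact: has_lead_uniq hm hm'.
Qed.

Lemma has_lc0 i P : has_lc i P 0 <-> dlt (deg P) (Some i).
Proof.
split=> h.
  have [m [<- hm]] := eventually_witness (eventually_and (lac_degP fd_iota P) h).
  exact/has_lead0.
by apply: eventually_mono (lac_degP fd_iota P) => m E; apply/has_lead0; rewrite E.
Qed.

Lemma has_lc_le i P c : has_lc i P c -> dle (deg P) (Some i).
Proof.
move=> h; have [m [<- hm]] := eventually_witness (eventually_and (lac_degP fd_iota P) h).
exact: has_lead_le hm.
Qed.

(** A coefficient found at one [m0] persists: [gap m0] exceeds [N] plus the absolute value of [i],
    so later substitutions change the image only in degrees below [i]. *)
Lemma has_lc_exists i P : dle (deg P) (Some i) -> exists c, has_lc i P c.
Proof.
move=> hP; have [N hN] := phi_close fd_iota P.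
have [N' [Q [_ E]]] := phi_repr fd_iota P.
have [m0 [hm0 gm0]] := eventually_witness (eventually_and (lac_degP fd_iota P)
  (gap_dominates (N + `|i|))).
have [|c hc] := @has_lead_exists _ _ _ i (E m0); first by rewrite hm0.
exists c, m0 => m m0m; apply: has_lead_near hc _.
have gN : (N + `|i| < gap m0)%N by apply: leq_ltn_trans gm0; rewrite leq_addl.
by apply: dle_lt_trans (hN _ _ m0m) _; rewrite /dlt /=; lia.
Qed.

Lemma has_lc_scalar c : has_lc 0 c%:A c.
Proof.
exists 0%N => m _; rewrite /has_lead phiC oppr0 expr0z mulr1 subrr degf0 //.
Qed.

Lemma has_lc1 : has_lc 0 1 1.
Proof. by have := has_lc_scalar 1; rewrite scale1r. Qed.

Lemma has_lcX : has_lc 1 X 1.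
Proof.
(* As [gap 0 = 0] and [gap 1 = 1], [lac m] is 1 modulo [t] once [m] is at least 1. *)
exists 1%N => m m1; rewrite /has_lead phiX polyC1 rmorph1 mul1r.
have -> : iota (lac k m) / t - t ^ (- 1) = iota (lac k m - 1) * t ^ (- 1).
  by rewrite rmorphB rmorph1 mulrBl mul1r.
apply: (@dlt_degMl _ _ _ _ 0 1) => //; last by rewrite fdeg_tXz.
apply: (@dle_lt_trans (Some (- 1%:Z))) => //; rewrite fd_iota (pdeg_le _ 1).
have := dvd_lacB k m1; rewrite [lac k 1]lacS /lac big_ord0 add0r //.
Qed.

Lemma has_lcY : has_lc (- 1) Y 1.
Proof.
by exists 0%N => m _; rewrite /has_lead phiY polyC1 rmorph1 mul1r subrr degf0.
Qed.

(** Scalar multiples of powers of [X] serve for [i] nonnegative, and of powers of [Y] for [i]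
    negative. *)
Lemma has_lc_surj i c : exists P, has_lc i P c.
Proof.
have pow j P d : has_lc j P 1 -> has_lc (j * d%:Z) (P ^+ d) 1.
  move=> h; elim: d => [|d IH].
    by rewrite expr0 mulr0; apply: has_lc1.
  rewrite exprS -[1]mulr1; apply: has_lcM h IH; lia.
have [P hP] : exists P, has_lc i P 1.
  case: i => d; first by exists (X ^+ d); rewrite -[Posz d]mul1r; apply: pow has_lcX.
  by exists (Y ^+ d.+1); rewrite NegzE -mulN1r; apply: pow has_lcY.
exists (c%:A * P); have := has_lcM (add0r i) (has_lc_scalar c) hP.
by rewrite mulr1.
Qed.

Lemma filt_lc_exists i (x : filt deg i) : exists c, has_lc i (filt_val x) c.
Proof. exact/has_lc_exists/filtP. Qed.

Definition gr_lc i (u : gr_data deg i) : k := projT1 (cid (filt_lc_exists (repr u))).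

(** Two representatives differ by an element of degree below [i], whose coefficient in degree [i] is
    zero. *)
Lemma gr_lc_class i (x : filt deg i) c :
  has_lc i (filt_val x) c -> gr_lc (gr_class x) = c.
Proof.
rewrite /gr_lc; case: cid => d /= hd hc.
have /gr_classE/has_lc0 h0 := gr_classK (gr_class x).
apply/eqP; rewrite -subr_eq0; apply/eqP; exact: has_lc_uniq (has_lcB hd hc) h0.
Qed.

Lemma gr_lcP i (u : gr_data deg i) :
  exists2 x : filt deg i, u = gr_class x & has_lc i (filt_val x) (gr_lc u).
Proof.
by exists (repr u); [rewrite gr_classK | rewrite /gr_lc; case: cid].
Qed.

Lemma has_lcD i P P' c d : has_lc i P c -> has_lc i P' d -> has_lc i (P + P') (c + d).
Proof.
move=> h h'; 
have -> : P + P' = P - (0 - P') by rewrite sub0r opprK.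
have -> : c + d = c - (0 - d) by rewrite sub0r opprK.
apply: has_lcB h _; apply: has_lcB h'; apply/has_lc0; rewrite degf0 //.
Qed.

Lemma gr_lcD i (u v : gr_data deg i) : gr_lc (u + v) = gr_lc u + gr_lc v.
Proof.
have [x ux hx] := gr_lcP u; have [y vy hy] := gr_lcP v.
rewrite {1}ux {1}vy -[_ + _]gr_classD; apply: gr_lc_class.
by rewrite filt_valD; apply: has_lcD.
Qed.

Lemma gr_lcM i j n (e : i + j = n) (u : gr_data deg i) (v : gr_data deg j) :
  gr_lc (gmul e u v) = gr_lc u * gr_lc v.
Proof.
have [x ux hx] := gr_lcP u; have [y vy hy] := gr_lcP v.
rewrite {1}ux {1}vy [gmul e _ _]gr_mul_class; apply: gr_lc_class.
exact: has_lcM e hx hy.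
Qed.

Lemma gr_lc_scalar c :
  gr_lc (gr_class (Filt (scalar_filt_subproof (lac_deg_scalars fd_iota) c))) = c.
Proof. exact/gr_lc_class/has_lc_scalar. Qed.

Lemma gr_lc1 : gr_lc (gone (gr_data deg)) = 1.
Proof. exact/gr_lc_class/has_lc1. Qed.

Lemma gr_lc_inj i : injective (@gr_lc i).
Proof.
move=> u v E; have [x ux hx] := gr_lcP u; have [y vy hy] := gr_lcP v.
rewrite ux vy; apply/gr_classE/has_lc0; rewrite -(subrr (gr_lc v)).
by apply: has_lcB hy; rewrite -E.
Qed.

Lemma gr_lc_surj i c : exists u : gr_data deg i, gr_lc u = c.
Proof.
have [P hP] := has_lc_surj i c.
by exists (gr_class (@Filt _ _ i P (has_lc_le hP))); apply: gr_lc_class.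
Qed.

Lemma lac_deg_Gr : Gr_iso_laurent (lac_deg_scalars fd_iota).
Proof.
exists (@graded_rmorphism (gr_data deg) (laurent_data k) gr_lc gr_lcD gr_lc1 gr_lcM).
split; first exact: (@graded_map_bij (gr_data deg) (laurent_data k) gr_lc gr_lcD gr_lc_inj gr_lc_surj).
move=> c; rewrite [LHS]graded_map_single /laurentC; congr dsingle.
exact: gr_lc_scalar.
Qed.

End LeadingCoefficient.

Theorem proposition1p2 (k : fieldType) (char0 : [pchar k] =i pred0) :
  exists deg : degree_function {mpoly k[2]},
  exists deg_k : deg_trivial_on_scalars deg,
    Gr_iso_laurent deg_k /\
    (forall D : {linear {mpoly k[2]} -> {mpoly k[2]}},
       is_derivation D ->
       (deg_defined deg D <-> forall p, D p = 0)).
Proof.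
pose iota : {rmorphism {poly k} -> {fraction {poly k}}} := @FracField.tofrac {poly k}.
have fdE p : frac_degree k (iota p) = pdeg p by exact: fdeg_poly.
exists (lac_deg fdE), (lac_deg_scalars fdE); split; first exact: lac_deg_Gr.
by move=> D; apply: lac_deg_defined.
Qed.
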